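(* Let $k$ be an $F$-finite field of characteristic $p>0$, and let $R$ be a strongly $F$-regular $k$-algebra, essentially of finite type over $k$, which is diagonally $F$-split over $k$. Let $\mathfrak p\subseteq R$ be a prime ideal and let $h$ be the height of $\mathfrak p$. Then $\mathfrak p^{(2hn)}\subseteq\mathfrak p^n$ for all integers $n>0$.
   Context: All rings are commutative. For a ring $R$ of prime characteristic $p$ and $e\ge 0$, $F^e_*$ denotes restriction of scalars along the $e$-th iterate of Frobenius $F^e\colon R\to R$, $x\mapsto x^{p^e}$: for an $R$-module $M$, $F^e_*M=\{F^e_*m : m\in M\}$ with $F^e_*m+F^e_*n=F^e_*(m+n)$ and $rF^e_*m=F^e_*(r^{p^e}m)$. $R$ is $F$-finite if $F^e_*R$ is a finitely generated $R$-module for some (equivalently all) $e>0$. An $F$-splitting of $R$ is an $R$-linear map $F^e_*R\to R$ (with $e>0$) sending $F^e_*1$ to $1$. Let $R$ be $F$-finite, reduced and Noetherian of characteristic $p$, and let $R^\circ$ be the set of elements of $R$ not in any minimal prime. $R$ is strongly $F$-regular if for every $d\in R^\circ$ there exist $e>0$ and $\varphi\in\operatorname{Hom}_R(F^e_*R,R)$ with $\varphi(F^e_*d)=1$. Diagonal $F$-splitting: let $\mu\colon R\otimes_kR\to R$, $\mu(x\otimes y)=xy$. $R$ is diagonally $F$-split over $k$ if for some $e>0$ there is an $F$-splitting $\varphi\colon F^e_*(R\otimes_kR)\to R\otimes_kR$ of $R\otimes_k R$ with $\varphi(F^e_*\ker\mu)\subseteq\ker\mu$. For a prime ideal $\mathfrak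 p$ of $R$, the $n$-th symbolic power is $\mathfrak p^{(n)}=\mathfrak p^nR_{\mathfrak p}\cap R$ (the preimage of $\mathfrak p^nR_{\mathfrak p}$ under $R\to R_{\mathfrak p}$).
   Formalization: The height h of the prime is assumed positive; for h = 0 the exponent 2hn is 0, the symbolic power is all of R, and the claimed inclusion fails (for example R = k, p = 0). *)

(* Defs.v *)
From HB Require Import structures.
From mathcomp Require Import all_boot all_order all_algebra.
From mathcomp Require Import sesquilinear ring_quotient classical_sets.

Set Implicit Arguments.
Unset Strict Implicit.
Unset Printing Implicit Defensive.

Import GRing.Theory.
Local Open Scope ring_scope.
Local Open Scope classical_set_scope.

Section Ideals.
Variable R : comNzRingType.
Implicit Types (A I P Q : set R).

Definition ideal_gen A : set R :=
  [set x | exists (m : nat) (a g : 'I_m -> R),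
     (forall i, A (g i)) /\ x = \sum_(i < m) a i * g i].

(* For n = 0 the only product is the empty one, so that I ^ 0 = R. *)
Definition ideal_pow I (n : nat) : set R :=
  ideal_gen [set x | exists g : 'I_n -> R,
     (forall i, I (g i)) /\ x = \prod_(i < n) g i].

(* [idealr_closed] includes properness. *)
Definition prime_ideal P : Prop :=
  idealr_closed [in P] /\ prime_idealr_closed [in P].

Definition minimal_prime P : Prop :=
  prime_ideal P /\ forall Q, prime_ideal Q -> Q `<=` P -> Q = P.

(* R^o in the usual notation; unrelated to the regular module R^o used below. *)
Definition off_minimal_primes : set R :=
  [set d | forall P, minimal_prime P -> ~ P d].

(* c 0 < c 1 < ... < c m = P, strict inclusions of primes; length m. *)
Definition prime_chain_to P (m : nat) (c : nat -> set R) : Prop :=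
  [/\ forall i, (i <= m)%N -> prime_ideal (c i),
      forall i, (i < m)%N -> c i `<` c i.+1
    & c m = P].

Definition height_is P (h : nat) : Prop :=
  (exists c, prime_chain_to P h c) /\
  (forall m c, prime_chain_to P m c -> (m <= h)%N).

(* Proper ideals suffice: the unit ideal is generated by 1. *)
Definition noetherian : Prop :=
  forall I, idealr_closed [in I] -> exists s : seq R, I = ideal_gen [set` s].

Definition reduced : Prop := forall (x : R) (n : nat), x ^+ n = 0 -> x = 0.

End Ideals.

Arguments noetherian R : clear implicits.
Arguments reduced R : clear implicits.

(* [f] exhibits [L] as the localization of [R] at the multiplicative set [W],
   up to the unique isomorphism: elements of [W] become units, every element
   of [L] is a fraction f s / f w, and ker f is the [W]-torsion. *)
Definition is_localization (R L : comNzRingType) (W : set R)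
    (f : {rmorphism R -> L}) : Prop :=
  [/\ forall w, W w -> exists v, v * f w = 1,
      forall y, exists s w, W w /\ y * f w = f s
    & forall s, f s = 0 <-> exists w, W w /\ w * s = 0].

(* P^n RP cap R, when [loc] is the localization map R -> RP at P. *)
Definition symbolic_power (R RP : comNzRingType) (loc : {rmorphism R -> RP})
    (P : set R) (n : nat) : set R :=
  loc @^-1` ideal_gen (loc @` ideal_pow P n).

Section Algebras.
Variable k : fieldType.

Definition finite_type (S : comAlgType k) : Prop :=
  exists gens : seq S, forall A : set S,
    subalg_closed [in A] -> [set` gens] `<=` A -> A = setT.

Definition essentially_finite_type (R : comAlgType k) : Prop :=
  exists (S : comAlgType k) (W : set S) (f : {lrmorphism S -> R}),
    [/\ finite_type S,
        W 1, forall v w, W v -> W w -> W (v * w)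
      & is_localization W f].

(* [T] with x (x) y := iota1 x * iota2 y is the tensor product of [A] and [B]
   over [k]: the universal target of k-bilinear maps on A * B.  Because iota1
   and iota2 are algebra morphisms, the ring structure of [T] is
   (x (x) y)(x' (x) y') = xx' (x) yy'. *)
Definition is_tensor_product (A B T : comAlgType k)
    (iota1 : {lrmorphism A -> T}) (iota2 : {lrmorphism B -> T}) : Prop :=
  forall (M : lmodType k) (b : {bilinear A -> B -> M}),
    (exists g : {linear T -> M}, forall x y, g (iota1 x * iota2 y) = b x y) /\
    (forall g g' : {linear T -> M},
       (forall x y, g (iota1 x * iota2 y) = b x y) ->
       (forall x y, g' (iota1 x * iota2 y) = b x y) -> g =1 g').

End Algebras.

(* F^e_* M: the abelian group M with scalars restricted along the e-th iterate
   of Frobenius. *)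
Definition Fpush (R : comNzRingType) (p : nat) (chR : p \in [pchar R])
  (e : nat) (M : lmodType R) : Type := M.

Section FpushModule.
Variables (R : comNzRingType) (p : nat) (chR : p \in [pchar R]).
Variables (e : nat) (M : lmodType R).

HB.instance Definition _ := GRing.Zmodule.on (Fpush chR e M).

Definition to_Fpush (m : M) : Fpush chR e M := m.

Definition Fpush_scale (r : R) (m : Fpush chR e M) : Fpush chR e M :=
  to_Fpush (r ^+ (p ^ e) *: (m : M)).

Fact Fpush_scaleA a b m :
  Fpush_scale a (Fpush_scale b m) = Fpush_scale (a * b) m.
Proof. by rewrite /Fpush_scale /to_Fpush scalerA exprMn. Qed.

Fact Fpush_scale1 : left_id 1 Fpush_scale.
Proof. by move=> m; rewrite /Fpush_scale /to_Fpush expr1n scale1r. Qed.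

Fact Fpush_scaleDr : right_distributive Fpush_scale +%R.
Proof. by move=> a m n; rewrite /Fpush_scale /to_Fpush -scalerDr. Qed.

Fact Fpush_scaleDl m : {morph Fpush_scale^~ m : a b / a + b}.
Proof.
have pe_nat : [pchar R].-nat (p ^ e)%N.
  by rewrite pnatX pnatE ?chR // (pcharf_prime chR).
by move=> a b; rewrite /Fpush_scale /to_Fpush exprDn_pchar // scalerDl.
Qed.

HB.instance Definition _ := GRing.Zmodule_isLmodule.Build R (Fpush chR e M)
  Fpush_scaleA Fpush_scale1 Fpush_scaleDr Fpush_scaleDl.

End FpushModule.

Arguments to_Fpush {R p} chR e {M} m.

Definition finitely_generated_module (R : comNzRingType) (M : lmodType R) :
    Prop :=
  exists (m : nat) (g : 'I_m -> M),
    forall x : M, exists a : 'I_m -> R, x = \sum_(i < m) a i *: g i.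

Section FrobeniusNotions.
Variables (R : comNzRingType) (p : nat) (chR : p \in [pchar R]).

Definition F_finite : Prop :=
  exists e, (0 < e)%N /\ finitely_generated_module (Fpush chR e R^o).

Definition is_F_splitting (e : nat) (phi : {linear Fpush chR e R^o -> R^o}) :
    Prop :=
  (0 < e)%N /\ phi (to_Fpush chR e (1 : R^o)) = 1.

Definition strongly_F_regular : Prop :=
  [/\ F_finite, reduced R, noetherian R
    & forall d, off_minimal_primes d ->
        exists (e : nat) (phi : {linear Fpush chR e R^o -> R^o}),
          (0 < e)%N /\ phi (to_Fpush chR e (d : R^o)) = 1].

End FrobeniusNotions.

Fact pchar_algebra (k : fieldType) (A : comAlgType k) (p : nat) :
  p \in [pchar k] -> p \in [pchar A].
Proof. by rewrite pchar_lalg. Qed.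

(* [T] is R (x)_k R; [mu] is determined by its values on pure tensors. *)
Definition diagonally_F_split (k : fieldType) (p : nat)
    (chk : p \in [pchar k]) (R : comAlgType k) : Prop :=
  exists (T : comAlgType k) (iota1 iota2 : {lrmorphism R -> T})
         (mu : {lrmorphism T -> R}),
    [/\ is_tensor_product iota1 iota2,
        forall x y, mu (iota1 x * iota2 y) = x * y
      & exists (e : nat)
               (phi : {linear Fpush (pchar_algebra T chk) e T^o -> T^o}),
          is_F_splitting phi /\
          forall z : T, mu z = 0 ->
            mu (phi (to_Fpush (pchar_algebra T chk) e (z : T^o))) = 0].

(* Main.v *)
(* A diagonal splitting phi of R (x) R, iterated to level Q = p^e, gives for
   a + b = Q the identity x = mu (phi (x^a (x) x^b)).  Expanding phi (x^a (x) x^b)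
   as a shortest sum of pure tensors, its left entries are values psi (x^a) and
   its right entries values psi' (x^b) of R-linear maps F^e_* R -> R.

   Locally at P, a power P^M with M >= (s + h - 1) Q + C lies in the ideal of
   Q-th powers of elements of P^s, with C independent of Q; such a map psi
   therefore sends P^(M) into P^(s).  The height enters through the analytic
   spread: any h + 1 generators of P satisfy locally a homogeneous relation with
   a unit coefficient, so that modulo higher powers P^M is spanned by monomials
   in which at most h exponents are large.

   For x in P^(2hn) take a just above hQ/(2hn).  Then psi (x^a) lies in P and
   psi' (x^b) in P^(2h(n-1)), because (2n - 1)h exceeds 2h(n - 1) + h - 1 by one
   and this slack absorbs C once Q is large.  Hence P^(2hn) is contained in
   P * P^(2h(n-1)), and one concludes by induction on n. *)
Require Import Defs.
From HB Require Import structures.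
From mathcomp Require Import all_boot all_order all_algebra.
From mathcomp Require Import sesquilinear ring_quotient boolp classical_sets.
From mathcomp Require Import ring zify.

Set Implicit Arguments.
Unset Strict Implicit.
Unset Printing Implicit Defensive.

Import GRing.Theory.
Local Open Scope ring_scope.
Local Open Scope classical_set_scope.

(** * Ideals and primes of a noetherian ring *)

Section Ideals.
Variable R : comNzRingType.
Implicit Types (A B I J P Q : set R) (x y z : R).

(* Unlike [idealr_closed], this allows the unit ideal. *)
Definition is_ideal I : Prop :=
  [/\ I 0, forall x y, I x -> I y -> I (x + y) & forall a x, I x -> I (a * x)].

Lemma idealr_closedP I : idealr_closed [in I] <-> is_ideal I /\ ~ I 1.
Proof.
split=> [[I0 I1 IM]|[[I0 ID IM] I1]].
  move: I0 I1; rewrite !inE => I0 I1; split=> //.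
    split=> // [x y Ix Iy|a x Ix].
      by have := IM 1 x y; rewrite !inE mul1r; apply; rewrite ?inE.
    by have := IM a x 0; rewrite !inE addr0; apply; rewrite ?inE.
  by move=> I1'; move/negP: I1; apply; rewrite inE.
split; rewrite ?inE //.
  by apply/negP; rewrite inE.
move=> a x y; rewrite !inE => Ix Iy.
by apply: ID => //; apply: IM.
Qed.

Lemma prime_idealP P :
  prime_ideal P <->
  [/\ is_ideal P, ~ P 1 & forall x y, P (x * y) -> P x \/ P y].
Proof.
split=> [[/idealr_closedP [PI P1] PM]|[PI P1 PM]].
  split=> // x y Pxy; have := PM x y; rewrite !inE => /(_ Pxy).
  by move=> /orP[]; rewrite inE; [left|right].
split; first by apply/idealr_closedP.
move=> x y; rewrite inE => Pxy; apply/orP.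
by have [] := PM _ _ Pxy; [left|right]; rewrite inE.
Qed.

Section IdealTheory.
Variables (I : set R) (idI : is_ideal I).

Lemma is_ideal0 : I 0. Proof. by case: idI. Qed.
Lemma is_idealD x y : I x -> I y -> I (x + y). Proof. by case: idI => _ + _; apply. Qed.
Lemma is_idealMl a x : I x -> I (a * x). Proof. by case: idI => _ _; apply. Qed.
Lemma is_idealMr a x : I x -> I (x * a). Proof. by rewrite mulrC; apply: is_idealMl. Qed.
Lemma is_idealN x : I x -> I (- x). Proof. by rewrite -mulN1r; apply: is_idealMl. Qed.
Lemma is_idealB x y : I x -> I y -> I (x - y).
Proof. by move=> Ix Iy; apply: is_idealD => //; apply: is_idealN. Qed.

Lemma is_ideal_sum (K : Type) (r : seq K) (Q : pred K) (F : K -> R) :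
  (forall i, Q i -> I (F i)) -> I (\sum_(i <- r | Q i) F i).
Proof. by move=> H; apply: big_ind => //; [apply: is_ideal0 | apply: is_idealD]. Qed.

Lemma ideal_gen_min A : A `<=` I -> ideal_gen A `<=` I.
Proof.
move=> AI _ [m [a [g [Ag ->]]]]; apply: is_ideal_sum => i _.
exact/is_idealMl/AI.
Qed.

End IdealTheory.

Lemma ideal_gen_ideal A : is_ideal (ideal_gen A).
Proof.
split.
- exists 0%N, (fun=> 0), (fun=> 0); split; first by case.
  by rewrite big_ord0.
- move=> _ _ [m [a [g [Ag ->]]]] [n [b [f [Af ->]]]].
  exists (m + n)%N, (fun i => match split i with inl j => a j | inr j => b j end),
    (fun i => match split i with inl j => g j | inr j => f j end); split.
    by move=> i; case: (split i).
  rewrite big_split_ord /=; congr (_ + _); apply: eq_bigr => i _.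
    by rewrite (unsplitK (inl i)).
  by rewrite (unsplitK (inr i)).
- move=> c _ [m [a [g [Ag ->]]]].
  exists m, (fun i => c * a i), g; split=> //.
  by rewrite mulr_sumr; apply: eq_bigr => i _; rewrite mulrA.
Qed.

Lemma sub_ideal_gen A : A `<=` ideal_gen A.
Proof.
move=> x Ax; exists 1%N, (fun=> 1), (fun=> x); split=> //.
by rewrite big_ord1 mul1r.
Qed.

Lemma ideal_gen_mono A B : A `<=` B -> ideal_gen A `<=` ideal_gen B.
Proof.
move=> AB; apply: ideal_gen_min; first exact: ideal_gen_ideal.
by apply: subset_trans AB _; apply: sub_ideal_gen.
Qed.

Lemma is_ideal_preimM I b : is_ideal I -> is_ideal [set x | I (x * b)].
Proof.
move=> idI; split=> /=.
- by rewrite mul0r; apply: is_ideal0.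
- by move=> x y Ix Iy; rewrite mulrDl; apply: is_idealD.
- by move=> a x Ix; rewrite -mulrA; apply: is_idealMl.
Qed.

Lemma ideal_gen_setU1 z A x :
  ideal_gen (z |` A) x -> exists a, ideal_gen A (x - a * z).
Proof.
have idA := ideal_gen_ideal A.
apply: (@ideal_gen_min [set x | exists a, ideal_gen A (x - a * z)]).
  split=> /=.
  - by exists 0; rewrite mul0r subr0; apply: is_ideal0.
  - move=> u v [a Aa] [b Ab]; exists (a + b).
    by rewrite mulrDl opprD addrACA; apply: is_idealD.
  - move=> c u [a Aa]; exists (c * a).
    by rewrite -mulrA -mulrBr; apply: is_idealMl.
move=> y [->|Ay] /=.
  by exists 1; rewrite mul1r subrr; apply: is_ideal0.
by exists 0; rewrite mul0r subr0; apply: sub_ideal_gen.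
Qed.

Lemma ideal_pow_ideal I n : is_ideal (ideal_pow I n).
Proof. exact: ideal_gen_ideal. Qed.

Lemma ideal_pow0 I x : ideal_pow I 0 x.
Proof.
rewrite -[x]mulr1; apply: (is_idealMl (ideal_pow_ideal _ _)).
apply: sub_ideal_gen; exists (fun=> 0); split; first by case.
by rewrite big_ord0.
Qed.

Lemma ideal_powM I m n x y :
  ideal_pow I m x -> ideal_pow I n y -> ideal_pow I (m + n) (x * y).
Proof.
move=> Hx Hy; have id := ideal_pow_ideal I (m + n).
move: x Hx; apply: (ideal_gen_min (is_ideal_preimM y id)).
move=> _ [f [If ->]] /=; rewrite mulrC.
move: y Hy; apply: (ideal_gen_min (is_ideal_preimM _ id)).
move=> _ [g [Ig ->]] /=; rewrite mulrC.
apply: sub_ideal_gen.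
exists (fun i => match split i with inl j => f j | inr j => g j end); split.
  by move=> i; case: (split i).
rewrite big_split_ord /=; congr (_ * _); apply: eq_bigr => i _.
  by rewrite (unsplitK (inl i)).
by rewrite (unsplitK (inr i)).
Qed.

Lemma ideal_pow1 I x : I x -> ideal_pow I 1 x.
Proof.
by move=> Ix; apply: sub_ideal_gen; exists (fun=> x); rewrite big_ord1.
Qed.

Lemma ideal_pow_exp I x n : I x -> ideal_pow I n (x ^+ n).
Proof.
move=> Ix; apply: sub_ideal_gen; exists (fun=> x).
by rewrite prodr_const card_ord.
Qed.

Lemma ideal_pow_pow I m n x : ideal_pow I m x -> ideal_pow I (m * n) (x ^+ n).
Proof.
move=> Ix; elim: n => [|n IHn]; first by rewrite muln0; apply: ideal_pow0.
by rewrite mulnS exprS; apply: ideal_powM.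
Qed.

Lemma ideal_pow_leq I m n : is_ideal I -> (n <= m)%N -> ideal_pow I m `<=` ideal_pow I n.
Proof.
move=> idI nm; apply: ideal_gen_min; first exact: ideal_pow_ideal.
rewrite -(subnKC nm) => _ [g [Ig ->]]; rewrite big_split_ord /=.
apply: (is_idealMr (ideal_pow_ideal _ _)); apply: sub_ideal_gen.
by exists (fun i => g (lshift _ i)).
Qed.

Lemma bigcup_ideal (F : set (set R)) :
  F !=set0 -> (forall I, F I -> is_ideal I) -> total_on F subset ->
  is_ideal (\bigcup_(I in F) I).
Proof.
move=> [I0 FI0] Fid Ftot; split.
- by exists I0 => //; exact: is_ideal0 (Fid _ FI0).
- move=> x y [I FI Ix] [J FJ Jy].
  by have [IJ|JI] := Ftot I J FI FJ; [exists J|exists I] => //;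
    (apply: is_idealD => //; first exact: Fid); [apply: IJ|apply: JI].
- by move=> a x [I FI Ix]; exists I => //; apply: is_idealMl => //; apply: Fid.
Qed.

Lemma noetherian_fg I : noetherian R -> is_ideal I ->
  exists s : seq R, I = ideal_gen [set` s].
Proof.
move=> noeth idI; have [I1|I1] := pselect (I 1); last first.
  by apply: noeth; apply/idealr_closedP.
exists [:: 1]; apply/seteqP; split=> x.
  move=> _; rewrite -[x]mulr1; apply: (is_idealMl (ideal_gen_ideal _)).
  by apply: sub_ideal_gen; rewrite /= inE.
apply: ideal_gen_min => // y /=; rewrite inE => /eqP ->; exact: I1.
Qed.

(** By Zorn's lemma: the union of a nonempty chain of ideals is finitely generated, its generators
    already lie in one member, and so the union equals that member. *)
Lemma noetherian_maximal (F : set (set R)) :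
  noetherian R -> (forall I, F I -> is_ideal I) -> F !=set0 ->
  exists I, F I /\ forall J, I `<` J -> ~ F J.
Proof.
move=> noeth Fid [I0 FI0].
have [|M [[M0|FM] Mmax]] := @Zorn_bigcup _ [set I | I = set0 \/ F I].
- move=> C CF Ctot /=.
  have [[I1 [CI1 I1n0]]|Cn] := pselect (exists I, C I /\ I <> set0); last first.
    left; apply/seteqP; split=> // x [I CI Ix]; apply: Cn.
    by exists I; split=> // I0'; rewrite I0' in Ix.
  right; pose C' := [set I | C I /\ I <> set0].
  have C'F I : C' I -> F I by case=> /CF[].
  have C'tot : total_on C' subset by move=> I J [? _] [? _]; apply: Ctot.
  have C'n0 : C' !=set0 by exists I1.
  have -> : \bigcup_(X in C) X = \bigcup_(X in C') X.
    apply/seteqP; split=> x [I CI Ix]; last by case: CI => CI _; exists I.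
    by exists I => //; split=> // I0'; rewrite I0' in Ix.
  set U := \bigcup_(X in C') X.
  have idU : is_ideal U by apply: bigcup_ideal => // I /C'F/Fid.
  have [s Us] := noetherian_fg noeth idU.
  have : exists2 I, C' I & [set` s] `<=` I.
    have : [set` s] `<=` U by rewrite [U]Us; apply: sub_ideal_gen.
    elim: (s) => [_|a l IHl al]; first by case: C'n0 => I CI; exists I.
    have [|I CI lI] := IHl.
      by move=> x /= xl; apply: al; rewrite /= inE xl orbT.
    have [J CJ Ja] : U a by apply: al; rewrite /= inE eqxx.
    have [IJ|JI] := C'tot I J CI CJ.
      exists J => // x /=; rewrite inE => /orP[/eqP ->//|xl].
      exact/IJ/lI.
    exists I => // x /=; rewrite inE => /orP[/eqP ->//|xl]; last exact: lI.
    exact: JI.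
  move=> [I CI sI]; suff -> : U = I by apply: C'F.
  apply/seteqP; split; last by move=> x Ix; exists I.
  by rewrite [U]Us; apply: ideal_gen_min => //; apply/Fid/C'F.
- have I0x : I0 0 := is_ideal0 (Fid _ FI0).
  case: (Mmax I0); last by right.
  by rewrite M0; split=> // /(_ 0 I0x).
- by exists M; split=> // J MJ FJ; apply: (Mmax J) => //; right.
Qed.

Lemma proper_adjoin I a : is_ideal I -> ~ I a -> I `<` ideal_gen (a |` I).
Proof.
move=> idI Ia; split; first by move=> x Ix; apply: sub_ideal_gen; right.
by move=> H; apply/Ia/H; apply: sub_ideal_gen; left.
Qed.

(** An ideal Q maximal among those over I that miss S is prime: for x and y outside Q, both Q + (x)
    and Q + (y) meet S, and the product of the two elements of S lies in Q + (xy). *)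
Lemma prime_avoiding I (S : set R) : noetherian R -> is_ideal I ->
  S 1 -> (forall x y, S x -> S y -> S (x * y)) -> (forall x, I x -> ~ S x) ->
  exists Q, [/\ prime_ideal Q, I `<=` Q & forall x, Q x -> ~ S x].
Proof.
move=> noeth idI S1 SM IS.
have [||Q [[idQ IQ QS] Qmax]] := @noetherian_maximal
    [set J | [/\ is_ideal J, I `<=` J & forall x, J x -> ~ S x]] noeth.
- by move=> J [].
- by exists I; split.
exists Q; split=> //; apply/prime_idealP; split=> //.
  by move=> Q1; apply: QS S1.
have meets a : ~ Q a -> exists s b, S s /\ Q (s - b * a).
  move=> Qa; have /Qmax : Q `<` ideal_gen (a |` Q) by apply: proper_adjoin.
  move=> H; apply: contrapT => noS; apply: H; split.
  - exact: ideal_gen_ideal.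
  - by move=> x Ix; apply: sub_ideal_gen; right; apply: IQ.
  - move=> x /ideal_gen_setU1 [b Hb] Sx; apply: noS; exists x, b; split=> //.
    exact: (ideal_gen_min idQ) Hb.
move=> x y Qxy; apply: contrapT => /not_orP[/meets [s [b [Ss Qs]]]].
move=> /meets [t [c [St Qt]]]; apply: (QS (s * t)); last exact: SM.
have -> : s * t = (s - b * x) * t + b * x * (t - c * y) + b * c * (x * y) by ring.
by do !apply: is_idealD => //; [apply: is_idealMr|apply: is_idealMl|apply: is_idealMl].
Qed.

(** Noetherian induction: a maximal counterexample M is proper and not prime, say xy is in M with x
    and y outside, and the lists for M + (x) and M + (y) together serve for M. *)
Lemma finitely_many_primes_over I : noetherian R -> is_ideal I ->
  exists Qs : seq (set R),
    (forall Q, List.In Q Qs -> prime_ideal Q /\ I `<=` Q) /\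
    (forall P, prime_ideal P -> I `<=` P -> exists2 Q, List.In Q Qs & Q `<=` P).
Proof.
move=> noeth idI; pose good J := exists Qs : seq (set R),
    (forall Q, List.In Q Qs -> prime_ideal Q /\ J `<=` Q) /\
    (forall P, prime_ideal P -> J `<=` P -> exists2 Q, List.In Q Qs & Q `<=` P).
apply: contrapT => badI.
have [||M [[idM badM] Mmax]] :=
    @noetherian_maximal [set J | is_ideal J /\ ~ good J] noeth.
- by move=> J [].
- by exists I; split.
have up a : ~ M a -> good (ideal_gen (a |` M)).
  move=> Ma; have /Mmax H : M `<` ideal_gen (a |` M) by apply: proper_adjoin.
  by apply: contrapT => ng; apply: H; split=> //; apply: ideal_gen_ideal.
have M1 : ~ M 1.
  move=> M1; apply: badM; exists [::]; split=> // P.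
  by move=> /prime_idealP[_ P1 _] MP; case: P1; apply: MP.
apply: badM; have [MP|] := pselect (prime_ideal M).
  exists [:: M]; split=> [Q [<-|//]|P _ MP']; first by split.
  by exists M => //; left.
move=> /prime_idealP nP; have [x [y [Mxy [Mx My]]]] :
    exists x y, M (x * y) /\ ~ M x /\ ~ M y.
  apply: contrapT => H; apply: nP; split=> // x y Mxy.
  by apply: contrapT => /not_orP[? ?]; apply: H; exists x, y.
have [Qs [Qs1 Qs2]] := up x Mx; have [Ts [Ts1 Ts2]] := up y My.
have Msub a : M `<=` ideal_gen (a |` M).
  by move=> z Mz; apply: sub_ideal_gen; right.
exists (Qs ++ Ts); split.
  move=> Q QQ; have [/Qs1[pQ H]|/Ts1[pQ H]] := List.in_app_or _ _ _ QQ; split=> //.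
    exact: subset_trans (Msub x) H.
  exact: subset_trans (Msub y) H.
move=> P pP MP; case/prime_idealP: (pP) => idP _ PM.
have [Px|Py] := PM x y (MP _ Mxy).
  have [|Q QQ QP] := Qs2 P pP.
    by apply: ideal_gen_min => // z [->|/MP].
  by exists Q => //; apply: List.in_or_app; left.
have [|Q QQ QP] := Ts2 P pP.
  by apply: ideal_gen_min => // z [->|/MP].
by exists Q => //; apply: List.in_or_app; right.
Qed.

(** If y avoids every prime but Q, add to it an element z of I that lies outside Q and inside all
    the others. *)
Lemma prime_avoidance I (Qs : seq (set R)) : is_ideal I ->
  (forall Q, List.In Q Qs -> prime_ideal Q /\ ~ (I `<=` Q)) ->
  exists2 y, I y & forall Q, List.In Q Qs -> ~ Q y.
Proof.
move=> idI; have [n] := ubnP (size Qs); elim: n Qs => // n IHn [_ _|Q Qs].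
  by exists 0 => //; apply: is_ideal0.
rewrite ltnS => /= szQ H; have [pQ IQ] := H Q (or_introl erefl).
(* Primes contained in Q are avoided as soon as Q is. Dropping them ensures that each remaining T
   has an element outside Q, from which z is built as a product. *)
pose Ts := List.filter (fun T => `[< ~ (T `<=` Q) >]) Qs.
have TsP T : List.In T Ts <-> List.In T Qs /\ ~ (T `<=` Q).
  by rewrite List.filter_In; split=> -[? /asboolP].
have [||y Iy yT] := IHn Ts.
- apply: leq_trans szQ; rewrite ltnS.
  by apply/leP; apply: List.filter_length_le.
- by move=> T /TsP [QT _]; apply: H; right.
have [Qy|Qy] := pselect (Q y); last first.
  exists y => // T [<-//|QT]; have [TQ|TQ] := pselect (T `<=` Q).
    by move=> /TQ.
  by apply: yT; apply/TsP.
have [idQ Q1 QM] := (prime_idealP Q).1 pQ.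
have [z0 Iz0 Qz0] : exists2 z, I z & ~ Q z.
  by apply: contrapT => N; apply: IQ => z Iz; apply: contrapT => Qz; apply: N; exists z.
have [z [Iz Qz zT]] : exists z, [/\ I z, ~ Q z & forall T, List.In T Ts -> T z].
  have : forall T, List.In T Ts -> is_ideal T /\ ~ (T `<=` Q).
    move=> T /TsP[QT TQ]; split=> //.
    by have [/prime_idealP []] := H T (or_intror QT).
  elim: (Ts) => [_|T l IHl Hl]; first by exists z0.
  have [|z [Iz Qz zl]] := IHl; first by move=> *; apply: Hl; right.
  have [idT TQ] := Hl T (or_introl erefl).
  have [w Tw Qw] : exists2 w, T w & ~ Q w.
    by apply: contrapT => N; apply: TQ => w Tw; apply: contrapT => Qw; apply: N; exists w.
  exists (w * z); split; [exact: is_idealMl|by move=> /QM[]|].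
  move=> T' [<-|T'l]; first exact: is_idealMr.
  apply: is_idealMl; last exact: zl.
  by have [] := Hl T' (or_intror T'l).
exists (y + z); first exact: is_idealD.
have nQ : ~ Q (y + z).
  by move=> Qyz; apply: Qz; rewrite -(addKr y z) addrC; apply: is_idealB.
move=> T [<-//|QT]; have [TQ|TQ] := pselect (T `<=` Q); first by move/TQ.
have TT : List.In T Ts by apply/TsP.
move=> Tyz; apply: (yT T TT); rewrite -(addrK z y).
have [/prime_idealP [idT _ _] _] := H T (or_intror QT).
by apply: is_idealB => //; apply: zT.
Qed.

End Ideals.

(** * Systems of parameters at a prime of height h *)

Section SystemOfParams.
Variables (R : comNzRingType) (noeth : noetherian R).
Variables (P : set R) (pP : prime_ideal P) (h : nat) (hP : height_is P h).

Lemma prime_chain_to_rcons (Q T : set R) (m : nat) c :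
  prime_chain_to Q m c -> prime_ideal T -> Q `<` T ->
  prime_chain_to T m.+1 (fun j => if (j <= m)%N then c j else T).
Proof.
case=> cp cl cm pT QT; split.
- by move=> i _; case: ifP => [/cp|].
- move=> i; rewrite ltnS => im; rewrite im; case: (ltnP i m) => [/cl //|mi].
  have -> : i = m by lia.
  by rewrite cm.
- by rewrite ltnn.
Qed.

Lemma prime_chain_to_behead (Q : set R) (i m : nat) c : (i <= m)%N ->
  prime_chain_to Q m c -> prime_chain_to Q i (fun j => c (j + (m - i))%N).
Proof.
move=> im [cp cl cm]; split.
- by move=> j ji; apply: cp; lia.
- by move=> j ji; rewrite addSn; apply: cl; lia.
- by rewrite subnKC.
Qed.

(* Each new element avoids the finitely many primes over the previous ones, so
   that a prime between the y_j and P acquires a chain longer by one. *)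
Lemma parameters_with_chains i : (i <= h)%N ->
  exists ys : seq R, [/\ size ys = i, [set` ys] `<=` P
    & forall Q, prime_ideal Q -> [set` ys] `<=` Q -> Q `<=` P ->
        exists c, prime_chain_to Q i c].
Proof.
elim: i => [_|i IHi ih].
  exists [::]; split=> // Q pQ _ _; exists (fun=> Q); split=> //.
have [ys [szys ysP ysQ]] := IHi (ltnW ih).
have [Qs [Qs1 Qs2]] :=
  finitely_many_primes_over noeth (ideal_gen_ideal [set` ys]).
pose Ts := List.filter (fun T => `[< ~ (P `<=` T) >]) Qs.
have TsP T : List.In T Ts <-> List.In T Qs /\ ~ (P `<=` T).
  by rewrite List.filter_In; split=> -[? /asboolP].
have [idP _ _] := (prime_idealP P).1 pP.
have [|y Py yT] := prime_avoidance idP (Qs := Ts).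
  by move=> T /TsP[/Qs1[]].
exists (y :: ys); split; first by rewrite /= szys.
  by move=> x /=; rewrite inE => /orP[/eqP ->//|/ysP].
move=> Q pQ yQ QP.
have ys_Q : [set` ys] `<=` Q by move=> x xy; apply: yQ; rewrite /= inE xy orbT.
have Qy : Q y by apply: yQ; rewrite /= inE eqxx.
(* Here Q = P, and the top part of a chain of length h below P has the required length. *)
have [PQ|PQ] := pselect (P `<=` Q).
  have <- : P = Q by apply/seteqP.
  by case: hP => -[c cP] _; have := prime_chain_to_behead ih cP; eexists; eassumption.
have [idQ _ _] := (prime_idealP Q).1 pQ.
have [T TQs TQ] := Qs2 Q pQ (ideal_gen_min idQ ys_Q).
have [pT genT] := Qs1 T TQs.
have yTn : ~ T y.
  by apply/yT/TsP; split=> // PT; apply/PQ/(subset_trans PT).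
have [|c cT] := ysQ T pT _ (subset_trans TQ QP).
  by apply: subset_trans genT; apply: sub_ideal_gen.
have TltQ : T `<` Q by split=> // QT; apply/yTn/QT.
by have := prime_chain_to_rcons cT pQ TltQ; eexists; eassumption.
Qed.

(** P is minimal over the y_j. If no c * x ^+ t lay in their ideal, a prime Q over it would avoid
    all these products; then Q is strictly inside P, and its chain of length h extends to P, against
    the height. *)
Lemma system_of_parameters :
  exists y : 'I_h -> R, (forall j, P (y j)) /\
    forall x, P x -> exists t c, ~ P c /\ ideal_gen (range y) (c * x ^+ t).
Proof.
have [ys [szys ysP ysQ]] := parameters_with_chains (leqnn h).
exists (fun j => nth 0 ys j); split.
  by move=> j; apply: ysP; rewrite /= mem_nth // szys.
move=> x Px; set y := fun j : 'I_h => _.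
have [idP P1 PM] := (prime_idealP P).1 pP.
pose S := [set z | exists t c, ~ P c /\ z = c * x ^+ t].
apply: contrapT => N.
have [|||Q [pQ yQ QS]] := prime_avoiding (S := S) noeth (ideal_gen_ideal (range y)).
- by exists 0%N, 1; rewrite mul1r.
- move=> _ _ [t [c [Pc ->]]] [t' [c' [Pc' ->]]].
  by exists (t + t')%N, (c * c'); split; [move=> /PM[]|rewrite exprD mulrACA].
- by move=> z Iz [t [c [Pc zE]]]; apply: N; exists t, c; rewrite -zE.
have QP : Q `<` P.
  split.
    by move=> z Qz; apply: contrapT => Pz; apply: (QS z Qz); exists 0%N, z; rewrite mulr1.
  by move=> /(_ x Px) Qx; apply: (QS x Qx); exists 1%N, 1; rewrite mul1r.
have [|c cQ] := ysQ Q pQ _ QP.1.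
  move=> z /= /(nthP 0) [i ilt <-]; apply/yQ/sub_ideal_gen.
  by rewrite szys in ilt; exists (Ordinal ilt).
by have := hP.2 _ _ (prime_chain_to_rcons cQ pP QP); rewrite ltnn.
Qed.

End SystemOfParams.

(** * Length bounds in the local ring at a prime *)

Section LocalIdeals.
Variables (R : comNzRingType) (P : set R) (pP : prime_ideal P).
Implicit Types (A B I J : set R) (x y z : R) (fs zs : seq R).

(* The contraction to R of the ideal of R_P generated by A. *)
Definition local_gen A : set R :=
  [set x | exists c, ~ P c /\ ideal_gen A (c * x)].

Let P1 : ~ P 1. Proof. by case/prime_idealP: pP. Qed.
Let PM c d : ~ P c -> ~ P d -> ~ P (c * d).
Proof. by case/prime_idealP: pP => _ _ H nc nd /H[]. Qed.

Lemma sub_local_gen A : ideal_gen A `<=` local_gen A.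
Proof. by move=> x Ax; exists 1; rewrite mul1r. Qed.

Lemma mem_local_gen A : A `<=` local_gen A.
Proof. exact: subset_trans (@sub_ideal_gen _ _) (@sub_local_gen _). Qed.

Lemma local_gen_ideal A : is_ideal (local_gen A).
Proof.
have idA := ideal_gen_ideal A; split.
- by apply: sub_local_gen; apply: is_ideal0.
- move=> x y [c [Pc Ax]] [d [Pd Ay]]; exists (c * d); split; first exact: PM.
  have -> : c * d * (x + y) = d * (c * x) + c * (d * y) by ring.
  by apply: is_idealD => //; apply: is_idealMl.
- move=> a x [c [Pc Ax]]; exists c; split=> //.
  by rewrite mulrCA; apply: is_idealMl.
Qed.

Lemma local_gen_cancel A c x : ~ P c -> local_gen A (c * x) -> local_gen A x.
Proof.
by move=> Pc [d [Pd Ax]]; exists (d * c); rewrite -mulrA; split=> //; apply: PM.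
Qed.

Lemma local_gen_sub A B : A `<=` local_gen B -> local_gen A `<=` local_gen B.
Proof.
move=> AB x [c [Pc Ax]]; apply: (local_gen_cancel Pc).
exact: ideal_gen_min (local_gen_ideal B) _ _ _ Ax.
Qed.

Lemma local_gen_mono A B : A `<=` B -> local_gen A `<=` local_gen B.
Proof.
by move=> AB; apply: local_gen_sub; apply: subset_trans AB (@mem_local_gen _).
Qed.

Lemma local_gen_mulr A B b x : (forall a, A a -> local_gen B (a * b)) ->
  local_gen A x -> local_gen B (x * b).
Proof.
move=> H [c [Pc Ax]]; apply: (local_gen_cancel Pc); rewrite mulrA.
exact: (ideal_gen_min (is_ideal_preimM b (local_gen_ideal B))) Ax.
Qed.

Lemma setU_cons J z zs : J `|` [set` z :: zs] = z |` (J `|` [set` zs]).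
Proof.
apply/seteqP; split=> x /=; rewrite inE.
  by move=> [Jx|/orP[/eqP ->|xz]]; [right; left|left|right; right].
by move=> [->|[Jx|xz]]; [right; rewrite eqxx|left|right; rewrite xz orbT].
Qed.

Lemma local_gen_cons J z zs x : local_gen (J `|` [set` z :: zs]) x ->
  exists c a, ~ P c /\ local_gen (J `|` [set` zs]) (c * x - a * z).
Proof.
rewrite setU_cons => -[c [Pc /ideal_gen_setU1 [a Ha]]].
by exists c, a; split=> //; apply: sub_local_gen.
Qed.

(** In R_P, the ideals generated by J and longer and longer tails of fs strictly increase. The
    notion depends on the order of fs. *)
Fixpoint local_indep J fs : Prop :=
  if fs is f :: fs' then
    ~ local_gen (J `|` [set` fs']) f /\ local_indep J fs'
  else True.

(** Each quotient of successive ideals, for J and the tails of zs, is cyclic and killed by P, hence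
    at most one-dimensional over the residue field. So [size zs] bounds the length of (J, zs) / J in
    R_P. *)
Fixpoint simple_chain J zs : Prop :=
  if zs is z :: zs' then
    (forall p, P p -> local_gen (J `|` [set` zs']) (p * z)) /\ simple_chain J zs'
  else True.

Lemma local_gen_cons_elim J A z fs :
  local_gen J `<=` local_gen A ->
  (forall p, P p -> local_gen A (p * z)) -> local_indep J fs ->
  (forall f, f \in fs -> exists c a, ~ P c /\ local_gen A (c * f - a * z)) ->
  exists fs', [/\ local_indep J fs', [set` fs'] `<=` local_gen A,
    [set` fs'] `<=` local_gen (J `|` [set` fs])
    & size fs = size fs' \/ size fs = (size fs').+1 /\
      exists g c, [/\ ~ P c, local_gen (J `|` [set` fs]) g
                    & local_gen A (c * z - g)]].
Proof.
move=> JA Pz; have idA := local_gen_ideal A.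
elim: fs => [_ _|f fs IHfs [nf indep] H].
  by exists [::]; split=> //; left.
have [|fs' [indep' fs'A fs'fs szfs]] := IHfs indep.
  by move=> g gfs; apply: H; rewrite inE gfs orbT.
have [c [a [Pc cfA]]] : exists c a, ~ P c /\ local_gen A (c * f - a * z).
  by apply: H; rewrite inE eqxx.
have mono : local_gen (J `|` [set` fs]) `<=` local_gen (J `|` [set` f :: fs]).
  by rewrite setU_cons; apply: local_gen_mono; right.
have memf : local_gen (J `|` [set` f :: fs]) f.
  by rewrite setU_cons; apply: mem_local_gen; left.
have idfs := local_gen_ideal (J `|` [set` fs]).
have idffs := local_gen_ideal (J `|` [set` f :: fs]).
have fs'sub : J `|` [set` fs'] `<=` local_gen (J `|` [set` fs]).
  by move=> x [Jx|/fs'fs //]; apply: mem_local_gen; left.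
have cons_ok f' : local_gen A f' -> local_gen (J `|` [set` f :: fs]) f' ->
    ~ local_gen (J `|` [set` fs']) f' ->
    [/\ local_indep J (f' :: fs'), [set` f' :: fs'] `<=` local_gen A
      & [set` f' :: fs'] `<=` local_gen (J `|` [set` f :: fs])].
  move=> Af' Jf' nf'; split=> // x /=; rewrite inE => /orP[/eqP ->//|xfs].
    exact: fs'A.
  exact/mono/fs'fs.
case: szfs => [szfs|[szfs [g [d [Pd gfs dzg]]]]].
  (* No pivot so far. If a is in P, then a * z is in A and f is kept; otherwise a is a unit at P and
     f becomes the pivot. *)
  have [Pa|Pa] := pselect (P a).
    have Af : local_gen A f.
      apply: (local_gen_cancel Pc); rewrite -(subrK (a * z) (c * f)).
      by apply: is_idealD => //; apply: Pz.
    have [||//|? ? ?] := cons_ok f => //.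
      by move=> /(local_gen_sub fs'sub).
    by exists (f :: fs'); split=> //; left; rewrite /= szfs.
  exists fs'; split=> //; first exact: subset_trans fs'fs mono.
  right; rewrite /= szfs; split=> //; exists (c * f), a; split=> //.
    exact: is_idealMl.
  by rewrite -opprB; apply: is_idealN.
(* The pivot cancels the multiple of z in f. Since d * c is a unit at P and g comes from the later
   entries, independence is preserved. *)
pose f' := d * (c * f) - a * g.
have Af' : local_gen A f'.
  have -> : f' = d * (c * f - a * z) + a * (d * z - g) by rewrite /f'; ring.
  by apply: is_idealD => //; apply: is_idealMl.
have [|||? ? ?] := cons_ok f' => //.
- by apply: is_idealB => //; do ?apply: is_idealMl => //; apply: mono.
- move=> /(local_gen_sub fs'sub) Hf'; apply: nf.
  apply: (local_gen_cancel (PM Pd Pc)).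
  have -> : d * c * f = f' + a * g by rewrite /f'; ring.
  by apply: is_idealD => //; apply: is_idealMl.
exists (f' :: fs'); split=> //; right; rewrite /= szfs; split=> //.
by exists g, d; split=> //; apply: mono.
Qed.

(** A strict chain of ideals is no longer than the length of the module containing it. The induction
    eliminates one z at a time, at the cost of at most one entry of fs. *)
Lemma local_indep_size J zs fs : simple_chain J zs -> local_indep J fs ->
  [set` fs] `<=` local_gen (J `|` [set` zs]) -> (size fs <= size zs)%N.
Proof.
elim: zs fs => [|z zs IHzs] fs.
  case: fs => // f fs _ [nf _] /(_ f); rewrite /= inE eqxx => /(_ isT) Hf.
  case: nf; apply: local_gen_mono Hf => x [Jx|//]; by left.
move=> [Pz chain] indep fsz.
have [|f /fsz /local_gen_cons //|fs' [indep' fs'A _ szfs]] :=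
    local_gen_cons_elim (A := J `|` [set` zs]) (J := J) _ Pz indep.
  by apply: local_gen_mono; left.
have := IHzs fs' chain indep' fs'A.
by case: szfs => [->|[-> _]] /=; lia.
Qed.

End LocalIdeals.

(** * Monomials with bounded exponents *)

Definition monomial (R : comNzRingType) r (x : 'I_r -> R) (v : 'I_r -> nat) : R :=
  \prod_i x i ^+ v i.

Definition mdeg r (v : 'I_r -> nat) : nat := \sum_i v i.

Section Monomials.
Variables (R : comNzRingType) (r : nat) (x : 'I_r -> R).
Implicit Types (P : set R) (v w : 'I_r -> nat).

Lemma monomialD v w :
  monomial x (fun i => v i + w i)%N = monomial x v * monomial x w.
Proof. by rewrite -big_split; apply: eq_bigr => i _; rewrite exprD. Qed.

Lemma eq_monomial v w : v =1 w -> monomial x v = monomial x w.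
Proof. by move=> vw; apply: eq_bigr => i _; rewrite vw. Qed.

Lemma monomial_pow P v : (forall i, P (x i)) -> ideal_pow P (mdeg v) (monomial x v).
Proof.
move=> Px; apply: (big_ind2 (fun z m => ideal_pow P m z)).
- exact: ideal_pow0.
- by move=> z m z' m'; apply: ideal_powM.
- by move=> i _; apply: ideal_pow_exp.
Qed.

Lemma ideal_pow_monomials P n : P `<=` ideal_gen (range x) ->
  ideal_pow P n `<=` ideal_gen [set monomial x v | v in [set v | mdeg v = n]].
Proof.
move=> Px; apply: ideal_gen_min; first exact: ideal_gen_ideal.
move=> _ [g [Pg ->]]; elim: n g Pg => [|n IHn] g Pg.
  rewrite big_ord0; apply: sub_ideal_gen; exists (fun=> 0%N).
    by rewrite /= /mdeg big1.
  by rewrite /monomial big1.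
rewrite big_ord_recl mulrC; have := IHn _ (fun i => Pg (lift ord0 i)).
set z := \prod_(i < n) _; move: z.
apply: ideal_gen_min; first exact/is_ideal_preimM/ideal_gen_ideal.
move=> _ [v /= vn <-]; rewrite mulrC; move: (g ord0) (Px _ (Pg ord0)).
apply: ideal_gen_min; first exact/is_ideal_preimM/ideal_gen_ideal.
move=> _ [i _ <-] /=; apply: sub_ideal_gen.
have del1 : \sum_j (j == i : nat) = 1%N.
  by rewrite (bigD1 i) //= eqxx big1 // => j /negPf ->.
exists (fun j => (j == i) + v j)%N.
  by rewrite /= /mdeg big_split /= del1 -/(mdeg v) vn.
rewrite monomialD; congr (_ * _); rewrite /monomial (bigD1 i) //= eqxx.
by rewrite big1 ?mulr1 // => j /negPf ->.
Qed.

End Monomials.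

Definition exps r N (f : {ffun 'I_r -> 'I_N}) : 'I_r -> nat := fun j => f j.

Section BoxMonomials.
Variables (R : comNzRingType) (r N : nat) (x : 'I_r -> R).
Implicit Types (f : {ffun 'I_r -> 'I_N.+1}) (i : 'I_r).

(** For a > N, [inord] would return 0; the lemmas on arbitrary values therefore assume a <= N. *)
Definition update f i (a : nat) : {ffun 'I_r -> 'I_N.+1} :=
  [ffun j => if j == i then inord a else f j].

Lemma monomial_update f i a : (a <= N)%N ->
  monomial x (exps (update f i a)) * x i ^+ f i = monomial x (exps f) * x i ^+ a.
Proof.
move=> aN; rewrite /monomial /exps (bigD1 i) //= [in RHS](bigD1 i) //= ffunE eqxx.
rewrite inordK //.
under eq_bigr => j /negPf ji do rewrite ffunE ji.
by ring.
Qed.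

Lemma mdeg_update f i a : (a <= N)%N ->
  (mdeg (exps (update f i a)) + f i = mdeg (exps f) + a)%N.
Proof.
move=> aN; rewrite /mdeg /exps (bigD1 i) //= [in RHS](bigD1 i) //= ffunE eqxx inordK //.
under eq_bigr => j /negPf ji do rewrite ffunE ji.
lia.
Qed.

Lemma monomial_incr f i : (f i < N)%N ->
  monomial x (exps (update f i (f i).+1)) = x i * monomial x (exps f).
Proof.
move=> fN; rewrite /monomial /exps (bigD1 i) //= [in RHS](bigD1 i) //= ffunE eqxx.
rewrite inordK // exprS mulrA; congr (_ * _).
by apply: eq_bigr => j /negPf ji; rewrite ffunE ji.
Qed.

Lemma monomial_clear f i :
  monomial x (exps f) = x i ^+ f i * monomial x (exps (update f i 0)).
Proof. by rewrite mulrC monomial_update // expr0 mulr1. Qed.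

Lemma mdeg_box_leq f : (mdeg (exps f) <= r * N)%N.
Proof.
rewrite /mdeg; apply: (@leq_trans (\sum_(i < r) N)).
  by apply: leq_sum => i _; rewrite -ltnS ltn_ord.
by rewrite sum_nat_const card_ord.
Qed.

End BoxMonomials.

(** * Analytic dependence of more than h generators *)

Section Dependence.
Variables (R : comNzRingType) (P : set R) (pP : prime_ideal P).
(** Sorting by increasing key places every element of larger key in the tail, even when keys tie. *)
Lemma simple_chain_sorted (T : eqType) (key : T -> nat) (z : T -> R) J s :
  (forall i p, P p ->
     local_gen P (J `|` [set z j | j in [set j | (key i < key j)%N]]) (p * z i)) ->
  sorted (relpre key leq) s ->
  (forall i j, i \in s -> (key i < key j)%N -> j \in s) ->
  simple_chain P J (map z s).
Proof.
have trans : transitive (relpre key leq) by move=> a b c; apply: leq_trans.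
move=> H; elim: s => // i s IHs is_s up; split.
  move=> p Pp; apply: local_gen_mono (H i p Pp) => // w [Jw|[j ij <-]]; first by left.
  have := up i j; rewrite !inE eqxx => /(_ isT ij).
  move=> /orP[/eqP ji|js]; first by rewrite /= ji ltnn in ij.
  by right; rewrite /= map_f.
apply: IHs; first exact: path_sorted is_s.
move=> i' j i's i'j; have := up i' j; rewrite !inE i's orbT => /(_ isT i'j).
move=> /orP[/eqP ji|//]; move: is_s => /(order_path_min trans)/allP /(_ _ i's) /=.
by rewrite -ji leqNgt i'j.
Qed.

(** Injectivity of the key makes the tail of a sorted list without repetition consist of strictly
    larger keys. *)
Lemma local_indep_sorted (T : eqType) (key : T -> nat) (z : T -> R) J s :
  injective key -> uniq s ->
  (forall i, i \in s ->
    ~ local_gen P (J `|` [set z j | j in [set j | (key i < key j)%N]]) (z i)) ->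
  sorted (relpre key leq) s -> local_indep P J (map z s).
Proof.
have trans : transitive (relpre key leq) by move=> a b c; apply: leq_trans.
move=> kinj; elim: s => // i s IHs /andP[ni us] H is_s; split; last first.
  apply: IHs => //; last exact: path_sorted is_s.
  by move=> j js; apply: H; rewrite inE js orbT.
move=> zi; apply: (H i); first by rewrite inE eqxx.
apply: local_gen_mono zi => // w [Jw|]; first by left.
move=> /= /mapP[j js ->]; right; exists j => //=.
move: is_s => /(order_path_min trans)/allP /(_ _ js) /=.
rewrite leq_eqVlt => /orP[/eqP/kinj ij|//].
by rewrite ij js in ni.
Qed.

Variables (r h t D : nat) (x : 'I_r -> R) (y : 'I_h -> R).
Hypothesis Px : P `<=` ideal_gen (range x).
Hypothesis Py : forall j, P (y j).
Hypothesis xt : forall i, local_gen P (range y) (x i ^+ t.+1).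

Let Idx := ({ffun 'I_h -> 'I_D.+1} * {ffun 'I_r -> 'I_t.+1})%type.
Let z (uw : Idx) : R := monomial y (exps uw.1) * monomial x (exps uw.2).
(** The degree in x is at most r * t, so this compares the degree in y first and the degree in x
    second. *)
Let key (uw : Idx) : nat := (mdeg (exps uw.1) * (r * t).+1 + mdeg (exps uw.2))%N.

(** Multiplication by x_i raises the exponent of x_i. At the top exponent t, the power x_i^(t+1) is
    locally a combination of the y_j, which raises the degree in y instead; past y_j^D the product
    falls into P^(D+1). *)
Lemma parameter_chain uw p : P p ->
  local_gen P (ideal_pow P D.+1 `|`
    [set z vw | vw in [set vw | (key uw < key vw)%N]]) (p * z uw).
Proof.
set B := _ `|` _; have idB := local_gen_ideal pP B.
move: p; apply: subset_trans Px _.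
apply: (ideal_gen_min (is_ideal_preimM (z uw) idB)) => _ [i _ <-] /=.
case: uw @B idB => u w B idB.
have [wi|wi] := ltnP (w i) t.
  apply: (mem_local_gen pP); right; exists (u, update w i (w i).+1) => /=.
    rewrite /key /= ltn_add2l; have := @mdeg_update r t w i (w i).+1 wi; lia.
  by rewrite /z /= monomial_incr // mulrCA.
have {}wi : w i = t :> nat by apply/eqP; rewrite eqn_leq wi -ltnS ltn_ord.
pose w0 := update w i 0.
have -> : x i * z (u, w) = x i ^+ t.+1 * (monomial y (exps u) * monomial x (exps w0)).
  by rewrite /z /= [monomial x (exps w)](monomial_clear x w i) wi exprS; ring.
apply: (local_gen_mulr pP) (xt i) => _ [j _ <-]; apply: (mem_local_gen pP).
have [uj|uj] := ltnP (u j) D.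
  right; exists (update u j (u j).+1, w0) => /=.
    rewrite /key /=; have := @mdeg_update h D u j (u j).+1 uj.
    by have := mdeg_box_leq w; nia.
  by rewrite /z /= monomial_incr // mulrA.
have {}uj : u j = D :> nat by apply/eqP; rewrite eqn_leq uj -ltnS ltn_ord.
left; rewrite [monomial y (exps u)](monomial_clear y u j) uj -!mulrA mulrA -exprS.
by apply: (is_idealMr (ideal_pow_ideal _ _)); apply: ideal_pow_exp.
Qed.

(* More than h of the generators are analytically dependent at P: the box of
   monomials they span has n^(h+1) elements, which exceeds the length
   D^h * t^r of the chain above once n is large. *)
Lemma analytic_dependence n (S : {set 'I_r})
    (kappa : {ffun 'I_r -> 'I_n.+1} -> nat) :
  injective kappa -> (D.+1 ^ h * t.+1 ^ r < n.+1 ^ #|S|)%N ->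
  exists alpha : {ffun 'I_r -> 'I_n.+1}, (forall i, i \notin S -> alpha i = ord0) /\
    local_gen P (ideal_pow P D.+1 `|`
      [set monomial x (exps beta) | beta in
        [set beta : {ffun 'I_r -> 'I_n.+1} | (kappa alpha < kappa beta)%N]])
      (monomial x (exps alpha)).
Proof.
(* Were there no such alpha, the box monomials sorted by kappa would be independent, and too many
   for the chain [zs]. *)
move=> kinj big_box; apply: contrapT => N.
pose mx (v : {ffun 'I_r -> 'I_n.+1}) := monomial x (exps v).
pose box := enum (pffun_on (ord0 : 'I_n.+1) [in S] predT).
pose fs := map mx (sort (relpre kappa leq) box).
pose zs := map z (sort (relpre key leq) (enum {: Idx})).
have szfs : size fs = (n.+1 ^ #|S|)%N.
  by rewrite size_map size_sort -cardE card_pffun_on card_ord.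
have szzs : size zs = (D.+1 ^ h * t.+1 ^ r)%N.
  by rewrite size_map size_sort -cardE card_prod !card_ffun !card_ord.
have sorted_ T (k : T -> nat) s : sorted (relpre k leq) (sort (relpre k leq) s).
  by apply: sort_sorted => a b; apply: leq_total.
have zs_chain : simple_chain P (ideal_pow P D.+1) zs.
  apply: (simple_chain_sorted (key := key)) => //.
    by move=> uw p; apply: parameter_chain.
  by move=> i j _ _; rewrite mem_sort mem_enum.
have fs_indep : local_indep P (ideal_pow P D.+1) fs.
  apply: (local_indep_sorted (key := kappa)) => //.
    by rewrite sort_uniq enum_uniq.
  move=> alpha; rewrite mem_sort mem_enum => /pffun_onP [supp _] H.
  apply: N; exists alpha; split=> // i iS.
  by apply/eqP; apply: contraNT iS => ai; move/fintype.subsetP: supp; apply.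
have := local_indep_size pP zs_chain fs_indep; rewrite szfs szzs leqNgt big_box.
suff H : [set` fs] `<=` local_gen P (ideal_pow P D.+1 `|` [set` zs]) by move=> /(_ H).
(* The list [zs] contains the monomial 1, so it generates the unit ideal. *)
move=> f _; rewrite -[f]mulr1; apply: (is_idealMl (local_gen_ideal pP _)).
apply: (mem_local_gen pP); right.
have -> : 1 = z ([ffun=> ord0], [ffun=> ord0]).
  by rewrite /z /monomial /exps !big1 ?mulr1 // => i _; rewrite ffunE.
by rewrite /= map_f // mem_sort mem_enum.
Qed.

End Dependence.

(** * Symbolic powers inside Frobenius powers *)

Section Weight.
Variables (r n : nat).
Implicit Types (v w : 'I_r -> nat) (f g : {ffun 'I_r -> 'I_n.+1}).

(* The degree-lexicographic order on exponents at most n, encoded in one number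
   so that it is additive. *)
Definition weight v : nat := (mdeg v * n.+1 ^ r + \sum_i v i * n.+1 ^ i)%N.

Lemma mdegD v w : mdeg (fun i => v i + w i)%N = (mdeg v + mdeg w)%N.
Proof. exact: big_split. Qed.

Lemma weightD v w : weight (fun i => v i + w i)%N = (weight v + weight w)%N.
Proof.
rewrite /weight mdegD; under eq_bigr do rewrite mulnDl.
by rewrite big_split /= mulnDl addnACA.
Qed.

Lemma digits_lt m (v : 'I_m -> nat) : (forall i, v i < n.+1)%N ->
  (\sum_i v i * n.+1 ^ i < n.+1 ^ m)%N.
Proof.
elim: m v => [|m IHm] v vn; first by rewrite big_ord0 expn0.
rewrite big_ord_recr /= expnS.
have := IHm _ (fun i => vn (widen_ord (leqnSn m) i)); have := vn ord_max.
by move: (\sum_(i < m) _)%N (n.+1 ^ m)%N => a b; nia.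
Qed.

Lemma digits_inj m (v w : 'I_m -> nat) :
  (forall i, v i < n.+1)%N -> (forall i, w i < n.+1)%N ->
  (\sum_i v i * n.+1 ^ i = \sum_i w i * n.+1 ^ i)%N -> v =1 w.
Proof.
elim: m v w => [|m IHm] v w vn wn; first by move=> _ [].
rewrite !big_ord_recr /= => E.
pose wid := widen_ord (leqnSn m).
have lv := digits_lt (fun i => vn (wid i)); have lw := digits_lt (fun i => wn (wid i)).
have Ev : v ord_max = w ord_max.
  move: lv lw E; rewrite /=; move: (\sum_(i < m) _)%N (\sum_(i < m) _)%N (n.+1 ^ m)%N.
  by move=> a b c ac bc; nia.
have Es : (\sum_(i < m) v (wid i) * n.+1 ^ i = \sum_(i < m) w (wid i) * n.+1 ^ i)%N.
  by move: E; rewrite Ev => /addIn.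
have {}IHm := IHm _ _ (fun i => vn (wid i)) (fun i => wn (wid i)) Es.
move=> i; case: (unliftP ord_max i) => [j ->|-> //].
have -> : lift ord_max j = wid j by apply: val_inj; rewrite /= /bump leqNgt ltn_ord.
exact: IHm.
Qed.

Let box f i : (exps f i < n.+1)%N. Proof. exact: ltn_ord. Qed.

(** The digit part is below (n+1)^r, so equal weights have equal degrees and equal digits in base
    n+1. *)
Lemma weight_inj : injective (fun f => weight (exps f)).
Proof.
move=> f g; rewrite /weight => E; apply/ffunP => i; apply: val_inj.
apply: (digits_inj (box f) (box g)).
move: E (digits_lt (box f)) (digits_lt (box g)).
move: (mdeg _) (mdeg _) (\sum_(i < r) _)%N (\sum_(i < r) _)%N (n.+1 ^ r)%N.
by move=> a b c d e ce de E; have [ab|ab|ab] := ltngtP a b; nia.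
Qed.

Lemma weight_lt_mdeg f g : (weight (exps f) < weight (exps g))%N ->
  (mdeg (exps f) <= mdeg (exps g))%N.
Proof.
move: (digits_lt (box f)) (digits_lt (box g)); rewrite /weight.
move: (mdeg _) (mdeg _) (\sum_(i < r) _)%N (\sum_(i < r) _)%N (n.+1 ^ r)%N.
by move=> a b c d e; nia.
Qed.

(** Only the smaller exponent has to lie in the box: its digits amount to less than one unit of
    degree. *)
Lemma mdeg_lt_weight f v : (mdeg (exps f) < mdeg v)%N ->
  (weight (exps f) < weight v)%N.
Proof.
move: (digits_lt (box f)); rewrite /weight.
move: (mdeg _) (mdeg _) (\sum_(i < r) _)%N (\sum_(i < r) _)%N (n.+1 ^ r)%N.
by move=> a b c d e; nia.
Qed.

(** Bounds the weight by the degree, so that an induction along increasing weight ends as long as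
    the degree stays bounded. *)
Lemma weight_leq v : (weight v <= mdeg v * (n.+1 ^ r).*2)%N.
Proof.
rewrite -addnn mulnDr leq_add2l /mdeg big_distrl /=; apply: leq_sum => i _.
by rewrite leq_mul2l leq_pexp2l ?orbT // ltnW.
Qed.

End Weight.

Section FrobeniusPowers.
Variables (R : comNzRingType) (P : set R) (pP : prime_ideal P).
Variables (r h t : nat) (x : 'I_r -> R) (y : 'I_h -> R).
Hypothesis (Px : P `<=` ideal_gen (range x)) (xP : forall i, P (x i)).
Hypothesis (Py : forall j, P (y j)).
Hypothesis xt : forall i, local_gen P (range y) (x i ^+ t.+1).
Variable n : nat.
Hypothesis n_big : ((r * n).+1 ^ h * t.+1 ^ r < n.+1 ^ h.+1)%N.
Hypothesis h_gt0 : (0 < h)%N.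
Variables (q s : nat).
Hypothesis q_gt0 : (0 < q)%N.

Let idP : is_ideal P. Proof. by case/prime_idealP: pP. Qed.
Let Iq : set R := [set g ^+ q | g in ideal_pow P s].

(** Division of every exponent by q splits off the q-th power of a monomial in P^s. *)
Lemma monomial_frobenius_power v :
  (s <= \sum_i v i %/ q)%N -> ideal_gen Iq (monomial x v).
Proof.
move=> sv; have -> : monomial x v =
    monomial x (fun i => v i %/ q)%N ^+ q * monomial x (fun i => v i %% q)%N.
  rewrite -prodrXl -big_split /=; apply: eq_bigr => i _.
  by rewrite -exprM -exprD -divn_eq.
apply: (is_idealMr (ideal_gen_ideal _)); apply: sub_ideal_gen.
eexists; last reflexivity.
exact: ideal_pow_leq sv _ (monomial_pow _ xP).
Qed.

(** Exponents in S lose at most q - 1 each to the remainder modulo q; those outside S are counted in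
    full. *)
Lemma mdeg_floor_leq v (S : {set 'I_r}) :
  (mdeg v <= \sum_(i | i \notin S) v i + #|S| * q.-1 + q * \sum_i v i %/ q)%N.
Proof.
rewrite /mdeg (bigID [in S]) /= addnC -addnA leq_add2l.
apply: (@leq_trans (#|S| * q.-1 + q * \sum_(i in S) v i %/ q)%N).
  rewrite -sum_nat_const big_distrr -big_split /=; apply: leq_sum => i _.
  rewrite {1}(divn_eq (v i) q) mulnC addnC leq_add2r.
  by rewrite -ltnS prednK // ltn_mod.
by rewrite leq_add2l leq_mul2l [X in (_ <= X)%N](bigID [in S]) /= leq_addr orbT.
Qed.

(** The hypothesis says that the degree is at least (s + h - 1) q + r n, without truncated
    subtraction. As long as more than h exponents are at least n, a dependence rewrites the monomial
    through monomials of no smaller degree and larger weight; the cases of large degree or of at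
    most h large exponents are direct. *)
Lemma monomial_local_frobenius_power v :
  ((s + h) * q + r * n <= mdeg v + q)%N -> local_gen P Iq (monomial x v).
Proof.
(* By [weight_leq], K exceeds the weight of every monomial of degree below (s + r) q, so K minus the
   weight decreases strictly. *)
pose K := ((s + r) * q * (n.+1 ^ r).*2)%N.
have [k] := ubnP (K - weight n v); elim: k v => // k IHk v; rewrite ltnS => vk big_v.
have [big|small] := leqP ((s + r) * q) (mdeg v).
  apply: (sub_local_gen pP); apply: monomial_frobenius_power.
  have := mdeg_floor_leq v [set: 'I_r]%SET; rewrite cardsT card_ord big1 => [|i]; last by rewrite inE.
  rewrite add0n; move: (\sum_i v i %/ q)%N => F; move: q_gt0 big; nia.
have vK : (weight n v < K)%N.
  apply: leq_ltn_trans (weight_leq n v) _.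
  by rewrite ltn_mul2r double_gt0 expn_gt0 small.
pose S : {set 'I_r} := [set i | (n <= v i)%N]%SET.
have [Sh|Sh] := leqP #|S| h.
  apply: (sub_local_gen pP); apply: monomial_frobenius_power.
  have := mdeg_floor_leq v S.
  have : (\sum_(i | i \notin S) v i <= r * n)%N.
    apply: (@leq_trans (\sum_(i < r | i \notin S) n)).
      by apply: leq_sum => i; rewrite inE -ltnNge => /ltnW.
    rewrite sum_nat_const leq_mul2r; apply/orP; right.
    by rewrite -[X in (_ <= X)%N]card_ord max_card.
  (* The remainders cost at most h (q - 1), strictly less than h q because h > 0; this forces the
     sum of the quotients up to s. *)
  move: (\sum_i v i %/ q)%N (\sum_(i | i \notin S) v i)%N => F G.
  have := leq_mul2r q.-1 #|S| h; rewrite Sh orbT.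
  by case: (q) q_gt0 big_v => // q' _; rewrite /=; nia.
have big_box : ((r * n).+1 ^ h * t.+1 ^ r < n.+1 ^ #|S|)%N.
  by apply: leq_trans n_big _; apply: leq_pexp2l.
(* The bound D is r n, the largest degree in the box: monomials of degree D + 1 then exceed alpha in
   degree, hence in weight. *)
have [alpha [suppS]] := analytic_dependence pP Px Py xt (@weight_inj r n) big_box.
set a := exps alpha => dep.
have av i : (a i <= v i)%N.
  have [iS|/suppS] := boolP (i \in S); last by rewrite /a /exps => ->.
  by move: iS; rewrite inE; apply: leq_trans; rewrite -ltnS; apply: ltn_ord.
(* On S one has a i <= n <= v i, and a vanishes off S, so the monomial of a divides that of v with
   cofactor exponent c. *)
pose c i := (v i - a i)%N.
have vE : v =1 (fun i => a i + c i)%N by move=> i; rewrite subnKC.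
have mE : mdeg v = (mdeg a + mdeg c)%N.
  by rewrite -mdegD; apply: eq_bigr => i _; apply: vE.
have wE : weight n v = (weight n a + weight n c)%N.
  rewrite -weightD /weight mE mdegD; congr (_ + _)%N.
  by apply: eq_bigr => i _; rewrite {1}vE.
have IH b : (mdeg a <= mdeg b)%N -> (weight n a < weight n b)%N ->
    local_gen P Iq (monomial x b * monomial x c).
  move=> ab wab; rewrite -monomialD; apply: IHk; last by rewrite mdegD; lia.
  by rewrite weightD; lia.
rewrite (eq_monomial _ vE) monomialD; apply: (local_gen_mulr pP) dep => w [Jw|].
  have idc := is_ideal_preimM (monomial x c) (local_gen_ideal pP Iq).
  apply: (ideal_gen_min idc) (ideal_pow_monomials Px Jw) => _ [b /= bD <-].
  have ab : (mdeg a < mdeg b)%N by rewrite bD ltnS; apply: mdeg_box_leq.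
  by apply: IH; [apply: ltnW|apply: mdeg_lt_weight].
by move=> [beta /= wab <-]; apply: IH => //; apply: weight_lt_mdeg wab.
Qed.

End FrobeniusPowers.

(** The constant C = r n depends only on P and the chosen generators and parameters, not on q, s or
    M. *)
Lemma symbolic_sub_frobenius_power (R : comNzRingType) (P : set R) (h : nat) :
  noetherian R -> prime_ideal P -> height_is P h -> (0 < h)%N ->
  exists C, forall q s M, (0 < q)%N -> ((s + h) * q + C <= M + q)%N ->
    local_gen P (ideal_pow P M) `<=`
    local_gen P [set g ^+ q | g in ideal_pow P s].
Proof.
move=> noeth pP hP h_gt0.
have [idP _ _] := (prime_idealP P).1 pP.
have [y [Py yP]] := system_of_parameters noeth pP hP.
have [gens Pgens] := noetherian_fg noeth idP.
pose r := size gens; pose x (i : 'I_r) := nth 0 gens i.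
have Px : P `<=` ideal_gen (range x).
  rewrite [X in X `<=` _]Pgens; apply: ideal_gen_mono => z /= /(nthP 0) [i ilt <-].
  by exists (Ordinal ilt).
have xP i : P (x i).
  by rewrite Pgens; apply: sub_ideal_gen; rewrite /= mem_nth.
have [/= tt ttP] := choice (fun i => yP _ (xP i)).
pose t := \max_i tt i.
have xt i : local_gen P (range y) (x i ^+ t.+1).
  have [c [Pc Hc]] := ttP i; exists c; split=> //.
  have /subnKC <- : (tt i <= t.+1)%N by apply/leqW/leq_bigmax.
  by rewrite exprD mulrA; apply: (is_idealMr (ideal_gen_ideal _)).
(* Since r n + 1 <= (r + 1)(n + 1), the left side of [n_big] is at most n (n + 1)^h. *)
pose n := (r.+1 ^ h * t.+1 ^ r)%N.
have n_big : ((r * n).+1 ^ h * t.+1 ^ r < n.+1 ^ h.+1)%N.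
  apply: (@leq_ltn_trans ((r.+1 * n.+1) ^ h * t.+1 ^ r)).
    rewrite leq_mul2r leq_exp2r //; apply/orP; right; nia.
  rewrite expnMn mulnAC expnS ltn_mul2r expn_gt0 /=; exact: ltnSn.
exists (r * n)%N => q s M q_gt0 big_M; apply: (local_gen_sub pP).
apply: subset_trans (ideal_pow_monomials Px) _.
apply: (ideal_gen_min (local_gen_ideal pP _)) => _ [v /= vM <-].
by apply: (monomial_local_frobenius_power pP Px xP Py xt n_big) => //; rewrite vM.
Qed.

(** * Diagonal splittings *)

Section Functionals.
Variables (k : fieldType) (V : lmodType k).

Definition is_subspace (U : set V) : Prop :=
  U 0 /\ forall (a : k) u v, U u -> U v -> U (a *: u + v).

(** A subspace M maximal among those that contain U but not b is a complement of the line through b;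
    the functional is the coefficient of b modulo M. *)
Lemma separating_functional (U : set V) b : is_subspace U -> ~ U b ->
  exists f : {linear V -> k^o}, (forall u, U u -> f u = 0) /\ f b = 1.
Proof.
move=> spU Ub.
pose ok X := [/\ is_subspace X, U `<=` X & ~ X b].
have [|M [[M0|[[M0 MD] UM Mb]] Mmax]] := @Zorn_bigcup _ [set X | X = set0 \/ ok X].
- move=> C CF Ctot /=.
  have [[X0 [CX0 okX0]]|Cn] := pselect (exists X, C X /\ ok X); last first.
    left; apply/seteqP; split=> // v [X CX Xv]; apply: Cn.
    by exists X; split=> //; have [XE|//] := CF X CX; rewrite XE in Xv.
  have okC X v : C X -> X v -> ok X by move=> /CF[-> //|].
  right; split; last by move=> [X CX Xb]; have [] := okC X _ CX Xb.
    split; first by exists X0 => //; case: okX0 => -[].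
    move=> a u v [X CX Xu] [Y CY Yv].
    have [[_ XD] _ _] := okC X _ CX Xu; have [[_ YD] _ _] := okC Y _ CY Yv.
    have [XY|YX] := Ctot X Y CX CY.
      by exists Y => //; apply: YD => //; apply: XY.
    by exists X => //; apply: XD => //; apply: YX.
  by move=> v Uv; exists X0 => //; case: okX0 => _ + _; apply.
- case: (Mmax U); last by right; split.
  by rewrite M0; split=> // /(_ 0 spU.1).
have MZ a u : M u -> M (a *: u) by move=> Mu; rewrite -[_ *: _]addr0; apply: MD.
(* For v outside M, maximality puts b into M + k v, and the coefficient of v there is invertible. *)
have coef v : exists c : k, M (v - c *: b).
  have [Mv|Mv] := pselect (M v); first by exists 0; rewrite scale0r subr0.
  pose M' := [set w | exists c : k, M (w - c *: v)].
  have MM' : M `<=` M' by move=> w Mw; exists 0; rewrite scale0r subr0.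
  have [c Mbc] : M' b.
    apply: contrapT => M'b; apply: (Mmax M').
      split=> // M'M; apply/Mv/M'M.
      by exists 1; rewrite scale1r subrr.
    right; split=> //; last exact: subset_trans UM MM'.
    split; first exact: MM'.
    move=> a u w [d Md] [d' Md']; exists (a * d + d').
    rewrite scalerDl -scalerA opprD addrACA -scalerBr; exact: MD.
  have c0 : c != 0.
    by apply/eqP => c0; rewrite c0 scale0r subr0 in Mbc.
  exists c^-1; have := MZ (- c^-1) _ Mbc.
  by rewrite scalerBr scalerA mulNr mulVf // scaleN1r opprK scaleNr addrC.
have [f fP] := choice coef.
have funiq v c : M (v - c *: b) -> f v = c.
  move=> Mc; apply/eqP; rewrite -subr_eq0; apply/negP => /negP fc0; apply: Mb.
  have := MZ (f v - c)^-1 _ (MD (-1) _ _ (fP v) Mc).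
  by rewrite scaleN1r opprB addrA subrK -scalerBl scalerA mulVf // scale1r.
have flin : linear (f : V -> k^o).
  move=> a u v; apply: funiq.
  rewrite scalerDl -[(a *: (f u : k^o)) *: b]scalerA opprD addrACA -scalerBr.
  exact: MD.
pose fm := GRing.isLinear.Build k V k^o _ f flin.
pose F : {linear V -> k^o} := HB.pack (f : V -> k^o) fm.
exists F; split.
  by move=> u Uu; apply: funiq; rewrite scale0r subr0; apply: UM.
by apply: funiq; rewrite scale1r subrr.
Qed.

End Functionals.

(** * Tensor products over a field and their slices *)

Section TensorProduct.
Variable k : fieldType.

Lemma tensor_product_sym (A B T : comAlgType k)
    (i1 : {lrmorphism A -> T}) (i2 : {lrmorphism B -> T}) :
  is_tensor_product i1 i2 -> is_tensor_product i2 i1.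
Proof.
move=> tens M b; pose b' x y := b y x.
have b'P : bilinear_for *:%R *:%R b'.
  split=> [u' a u v|u a u' v']; rewrite /b'; first exact: linearPr.
  exact: linearPl.
pose bm := bilinear_isBilinear.Build k A B M _ _ b' b'P.
pose BM : {bilinear A -> B -> M} := HB.pack b' bm.
have [[g gE] guniq] := tens M BM.
split; first by exists g => x y; rewrite mulrC gE.
move=> g1 g2 H1 H2; apply: guniq => x y; rewrite mulrC; [exact: H1|exact: H2].
Qed.

Variables (A B T : comAlgType k).
Variables (i1 : {lrmorphism A -> T}) (i2 : {lrmorphism B -> T}).
Hypothesis tens : is_tensor_product i1 i2.

Definition pure_sum (t : T) (m : nat) : Prop :=
  exists (a : 'I_m -> A) (b : 'I_m -> B), t = \sum_i i1 (a i) * i2 (b i).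

(** Uniqueness in the universal property: a functional that kills all pure tensors is 0, so it
    cannot separate t from their span. *)
Lemma pure_sum_ex t : exists m, pure_sum t m.
Proof.
pose U := [set t | exists m, pure_sum t m].
have spU : is_subspace U.
  split; first by exists 0%N, (fun=> 0), (fun=> 0); rewrite big_ord0.
  move=> c _ _ [m [a [b ->]]] [n [a' [b' ->]]]; exists (m + n)%N.
  exists (fun i => match split i with inl j => c *: a j | inr j => a' j end).
  exists (fun i => match split i with inl j => b j | inr j => b' j end).
  rewrite big_split_ord /= scaler_sumr; congr (_ + _); apply: eq_bigr => i _.
    by rewrite (unsplitK (inl i)) linearZ scalerAl.
  by rewrite (unsplitK (inr i)).
apply: contrapT => Ut; have [f [fU ft]] := separating_functional spU Ut.
pose b0 (x : A) (y : B) : k^o := 0.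
have b0P : bilinear_for *:%R *:%R b0.
  by split=> [u' a u v|u a u' v']; rewrite /b0 /= addr0 ?scaler0.
pose bm := bilinear_isBilinear.Build k A B k^o _ _ b0 b0P.
pose BM : {bilinear A -> B -> k^o} := HB.pack b0 bm.
have [_ uniq_map] := tens BM.
have := uniq_map f (\0 : {linear T -> k^o}) _ _ t; rewrite ft.
move=> /(_ _ _)/eqP; rewrite oner_eq0 => H; suff: false by [].
apply: H => // x y; apply: fU; exists 1%N, (fun=> x), (fun=> y).
by rewrite big_ord1.
Qed.

(** The map is id (x) f followed by the identification of A (x) k with A. *)
Lemma slice (f : {linear B -> k^o}) : exists g : {linear T -> A},
  (forall x y, g (i1 x * i2 y) = (f y : k) *: x) /\
  forall x t, g (i1 x * t) = x * g t.
Proof.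
pose b (x : A) (y : B) : A := (f y : k) *: x.
have bP : bilinear_for *:%R *:%R b.
  split=> [u' a u v|u a u' v']; rewrite /b /=.
    by rewrite scalerDr !scalerA mulrC.
  by rewrite linearP scalerDl -scalerA.
pose bm := bilinear_isBilinear.Build k A B A _ _ b bP.
pose BM : {bilinear A -> B -> A} := HB.pack b bm.
have [[g gE] _] := tens BM.
exists g; split=> // x t; have [m [u [v ->]]] := pure_sum_ex t.
rewrite mulr_sumr !linear_sum mulr_sumr; apply: eq_bigr => i _.
by rewrite mulrA -rmorphM !gE /= /b scalerAr.
Qed.

(** A linear relation among the right entries moves the i-th term into the left entries of the
    others. *)
Lemma pure_sum_shorten t m (a : 'I_m.+1 -> A) (b : 'I_m.+1 -> B) i
    (c : 'I_m -> k) :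
  b i = \sum_j c j *: b (lift i j) -> t = \sum_j i1 (a j) * i2 (b j) ->
  pure_sum t m.
Proof.
move=> bi ->; exists (fun j => a (lift i j) + c j *: a i), (fun j => b (lift i j)).
rewrite (bigD1_ord i) //= bi linear_sum mulr_sumr -big_split /=.
apply: eq_bigr => j _; rewrite addrC linearD mulrDl !linearZ /=.
by rewrite -scalerAl -scalerAr.
Qed.

End TensorProduct.

Section ReducedTensors.
Variable k : fieldType.

Lemma dual_functional (V : lmodType k) m (b : 'I_m.+1 -> V) i :
  ~ (exists c : 'I_m -> k, b i = \sum_j c j *: b (lift i j)) ->
  exists f : {linear V -> k^o}, f (b i) = 1 /\ forall j, j != i -> f (b j) = 0.
Proof.
move=> bi; pose U := [set v | exists c : 'I_m -> k, v = \sum_j c j *: b (lift i j)].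
have spU : is_subspace U.
  split; first by exists (fun=> 0); rewrite big1 // => j _; rewrite scale0r.
  move=> a _ _ [c ->] [d ->]; exists (fun j => a * c j + d j).
  rewrite scaler_sumr -big_split; apply: eq_bigr => j _ /=.
  by rewrite scalerDl scalerA.
have [f [fU fb]] := separating_functional spU bi.
exists f; split=> // j ji; apply: fU.
have [j' ->|jE] := unliftP i j; last by rewrite jE eqxx in ji.
exists (fun l => (l == j')%:R); rewrite (bigD1 j') //= eqxx scale1r.
by rewrite big1 ?addr0 // => l /negPf ->; rewrite scale0r.
Qed.

(* A shortest expression as a sum of pure tensors has linearly independent
   entries on both sides, so every entry is the value at t of a slice. *)
Lemma tensor_entries (A B T : comAlgType k)
    (i1 : {lrmorphism A -> T}) (i2 : {lrmorphism B -> T}) (t : T) :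
  is_tensor_product i1 i2 ->
  exists m (a : 'I_m -> A) (b : 'I_m -> B),
    [/\ t = \sum_i i1 (a i) * i2 (b i),
        forall i, exists g : {linear T -> A},
          (forall x s, g (i1 x * s) = x * g s) /\ g t = a i
      & forall i, exists g : {linear T -> B},
          (forall x s, g (i2 x * s) = x * g s) /\ g t = b i].
Proof.
move=> tens; have sym := tensor_product_sym tens.
have ex : exists m, `[< pure_sum i1 i2 t m >].
  by have [m Hm] := pure_sum_ex tens t; exists m; apply/asboolP.
case: (ex_minnP ex) => -[|m] /asboolP [a [b tE]] min.
  by exists 0%N, a, b; split=> // -[].
have {}min : ~ pure_sum i1 i2 t m.
  by move=> /asboolP/min; rewrite ltnn.
exists m.+1, a, b; split=> // i.
  have [f [fi fj]] : exists f : {linear B -> k^o},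
      f (b i) = 1 /\ forall j, j != i -> f (b j) = 0.
    by apply: dual_functional => -[c bi]; apply/min/(pure_sum_shorten bi tE).
  have [g [gE gM]] := slice tens f; exists g; split=> //.
  rewrite tE linear_sum (bigD1 i) //= gE fi scale1r big1 ?addr0 // => j ji.
  by rewrite gE fj // scale0r.
have [f [fi fj]] : exists f : {linear A -> k^o},
    f (a i) = 1 /\ forall j, j != i -> f (a j) = 0.
  apply: dual_functional => -[c ai]; apply: min.
  have [|b' [a' E]] := pure_sum_shorten (i1 := i2) (i2 := i1) (t := t) (a := b) ai.
    by rewrite tE; apply: eq_bigr => j _; rewrite mulrC.
  by exists a', b'; rewrite E; apply: eq_bigr => j _; rewrite mulrC.
have [g [gE gM]] := slice sym f; exists g; split=> //.
rewrite tE linear_sum (bigD1 i) //= mulrC gE fi scale1r big1 ?addr0 // => j ji.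
by rewrite mulrC gE fj // scale0r.
Qed.

End ReducedTensors.

(* For Q = p^e these are the R-linear maps from F^e_* R to R. *)
Definition Cartier_linear (R : comNzRingType) (Q : nat) (psi : R -> R) : Prop :=
  (forall c d, psi (c + d) = psi c + psi d) /\
  forall r c, psi (r ^+ Q * c) = r * psi c.

Lemma Cartier_linear_iter (R : comNzRingType) Q (psi : R -> R) m :
  Cartier_linear Q psi -> Cartier_linear (Q ^ m) (iter m psi).
Proof.
move=> [psiD psiM]; split=> [c d|r c].
  by elim: m => //= m ->.
elim: m r => [|m IHm] r; first by rewrite expn0 expr1.
by rewrite expnS exprM iterS IHm psiM.
Qed.

(** The tensors x^a (x) x^b and x^Q (x) 1 differ by an element of ker mu, and phi sends the second
    to x (x) 1. *)
Lemma diagonal_subadditivity (k : fieldType) (R T : comAlgType k)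
    (i1 i2 : {lrmorphism R -> T}) (mu : {lrmorphism T -> R}) Q (phi : T -> T) :
  is_tensor_product i1 i2 -> (forall x y, mu (i1 x * i2 y) = x * y) ->
  Cartier_linear Q phi -> phi 1 = 1 ->
  (forall z, mu z = 0 -> mu (phi z) = 0) ->
  forall x a b, (a + b)%N = Q ->
  exists m (psi psi' : 'I_m -> R -> R),
    [/\ forall i, Cartier_linear Q (psi i), forall i, Cartier_linear Q (psi' i)
      & x = \sum_i psi i (x ^+ a) * psi' i (x ^+ b)].
Proof.
move=> tens muE [phiD phiM] phi1 phimu x a b abQ.
have muE1 y : mu (i1 y) = y by have := muE y 1; rewrite rmorph1 !mulr1.
have muE2 y : mu (i2 y) = y by have := muE 1 y; rewrite rmorph1 !mul1r.
have phiN z : phi (- z) = - phi z.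
  apply/eqP; rewrite -addr_eq0 -phiD addNr.
  by apply/eqP/(addrI (phi 0)); rewrite -phiD !addr0.
set t := phi (i1 (x ^+ a) * i2 (x ^+ b)).
have mut : mu t = x.
  have : mu (phi (i1 (x ^+ a) * i2 (x ^+ b) - i1 x ^+ Q * 1)) = 0.
    apply: phimu; rewrite mulr1 rmorphB /= muE -rmorphXn /= muE1 -exprD abQ.
    by rewrite subrr.
  by rewrite phiD phiN phiM phi1 mulr1 rmorphB /= muE1 => /eqP; rewrite subr_eq0 => /eqP.
have [m [u [v [tE uE vE]]]] := tensor_entries t tens.
have [g gP] := choice uE; have [g' g'P] := choice vE.
(* Fixing one tensor factor and slicing the value of phi gives a map that is Cartier linear in the
   other factor. *)
exists m, (fun i c => g i (phi (i1 c * i2 (x ^+ b)))),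
  (fun i c => g' i (phi (i1 (x ^+ a) * i2 c))); split=> [i|i|].
- split=> [c d|r c]; first by rewrite rmorphD mulrDl phiD linearD.
  by rewrite rmorphM rmorphXn /= -mulrA phiM (gP i).1.
- split=> [c d|r c]; first by rewrite rmorphD mulrDr phiD linearD.
  by rewrite rmorphM /= mulrCA (rmorphXn i2) phiM (g'P i).1.
- rewrite -[LHS]mut tE rmorph_sum; apply: eq_bigr => i _.
  by rewrite rmorphM /= muE1 muE2 (gP i).2 (g'P i).2.
Qed.

(** * Symbolic powers under Frobenius-linear maps *)

Section SymbolicPowers.
Variables (R : comNzRingType) (P : set R) (pP : prime_ideal P).

Let idP : is_ideal P. Proof. by case/prime_idealP: pP. Qed.
Let PX c n : ~ P c -> ~ P (c ^+ n).
Proof.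
case/prime_idealP: pP => _ P1 PM Pc; elim: n => [|n IHn]; first by rewrite expr0.
by rewrite exprS => /PM[].
Qed.

Lemma local_gen_exp M n z :
  local_gen P (ideal_pow P M) z -> local_gen P (ideal_pow P (M * n)) (z ^+ n).
Proof.
move=> [c [Pc Hc]]; exists (c ^+ n); split; first exact: PX.
apply: sub_ideal_gen; rewrite -exprMn; apply: ideal_pow_pow.
exact: (ideal_gen_min (ideal_pow_ideal P M)) Hc.
Qed.

Lemma local_gen_pow1 : local_gen P (ideal_pow P 1) `<=` P.
Proof.
move=> z [c [Pc Hc]].
have Pcz : P (c * z).
  apply: (ideal_gen_min idP) Hc; apply: ideal_gen_min => // _ [g [Pg ->]].
  by rewrite big_ord1.
by case/prime_idealP: pP => _ _ /(_ _ _ Pcz)[].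
Qed.

(** On generators, psi (a g^Q) = g psi a. The denominator c is first raised to c^Q, so that it too
    comes out of psi. *)
Lemma Cartier_frobenius_power Q psi s z : (0 < Q)%N -> Cartier_linear Q psi ->
  local_gen P [set g ^+ Q | g in ideal_pow P s] z ->
  local_gen P (ideal_pow P s) (psi z).
Proof.
move=> Q0 [psiD psiM] [c [Pc Hc]]; exists c; split=> //.
apply: sub_ideal_gen; rewrite -psiM.
have := is_idealMl (ideal_gen_ideal _) (c ^+ Q.-1) Hc.
rewrite mulrA -exprSr prednK //; move: (_ * z).
have ids := ideal_pow_ideal P s.
have psi0 : psi 0 = 0 by apply: (addrI (psi 0)); rewrite -psiD !addr0.
move=> _ [m [a [g [Pg ->]]]].
rewrite (big_morph psi psiD psi0); apply: is_ideal_sum => // i _.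
have [w Pw <-] := Pg i.
by rewrite mulrC psiM; apply: is_idealMr.
Qed.

Lemma symbolic_power_local_gen (RP : comNzRingType) (loc : {rmorphism R -> RP}) N :
  is_localization (~` P) loc ->
  symbolic_power loc P N `<=` local_gen P (ideal_pow P N).
Proof.
move=> [_ frac ker] x; rewrite /symbolic_power /=.
case/prime_idealP: (pP) => _ P1 PM.
have PMn c d : ~ P c -> ~ P d -> ~ P (c * d) by move=> nc nd /PM[].
have idN := ideal_pow_ideal P N.
(* The fractions with numerator in P^N form an ideal of R_P containing the image of P^N. *)
pose I := [set y | exists w s, [/\ ~ P w, ideal_pow P N s & y * loc w = loc s]].
have idI : is_ideal I.
  split.
  - by exists 1, 0; rewrite rmorph0 mul0r; split=> //; apply: is_ideal0.
  - move=> y y' [w [s [Pw Ns ys]]] [w' [s' [Pw' Ns' ys']]].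
    exists (w * w'), (s * w' + s' * w); split; first exact: PMn.
      by apply: is_idealD => //; apply: is_idealMr.
    by rewrite rmorphD !rmorphM -ys -ys' /=; ring.
  - move=> a y [w [s [Pw Ns ys]]]; have [s0 [w0 [Pw0 E]]] := frac a.
    exists (w0 * w), (s0 * s); split; [exact: PMn|exact: is_idealMl|].
    by rewrite !rmorphM /= -E -ys; ring.
move=> Hx; have : I (loc x).
  apply: (ideal_gen_min idI) Hx => _ [s Ns <-].
  by exists 1, s; rewrite rmorph1 mulr1; split.
move=> [w [s [Pw Ns E]]].
have [w' [Pw' Ew']] : exists w', (~` P) w' /\ w' * (x * w - s) = 0.
  by apply/ker; rewrite rmorphB rmorphM E subrr.
exists (w' * w); split; first exact: PMn.
apply: sub_ideal_gen.
have -> : w' * w * x = w' * s.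
  by apply/eqP; rewrite -subr_eq0 -Ew'; apply/eqP; ring.
exact: is_idealMl.
Qed.

End SymbolicPowers.

(** For h = 0 the exponent 2 * h * n is 0 and the symbolic power is all of R, whereas P^n is proper;
    hence [h_gt0]. *)
Theorem theoremB (p : nat) (k : fieldType) (chk : p \in [pchar k])
  (Fk : F_finite chk)
  (R : comAlgType k)
  (R_eft : essentially_finite_type R)
  (R_sfr : strongly_F_regular (pchar_algebra R chk))
  (R_diag : diagonally_F_split chk R)
  (P : set R) (P_prime : prime_ideal P)
  (RP : comNzRingType) (loc : {rmorphism R -> RP})
  (loc_P : is_localization (~` P) loc)
  (h : nat) (h_height : height_is P h) (h_gt0 : (0 < h)%N)
  (n : nat) (n_gt0 : (0 < n)%N) :
  symbolic_power loc P (2 * h * n)%N `<=` ideal_pow P n.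
Proof.
have [_ _ noeth _] := R_sfr.
have [C sub_frob] := symbolic_sub_frobenius_power noeth P_prime h_height h_gt0.
have [T [i1 [i2 [mu [tens muE [e [phi [[e_gt0 phi1] phimu]]]]]]]] := R_diag.
pose f (z : T) : T := phi (to_Fpush (pchar_algebra T chk) e (z : T^o)).
have fC : Cartier_linear (p ^ e) f.
  split=> [c d|r c]; first exact: (linearD phi).
  exact: (linearZ_LR phi r (to_Fpush _ e (c : T^o))).
have pe_gt1 : (1 < p ^ e)%N.
  by rewrite -[1%N](exp1n e) ltn_exp2r // prime_gt1 // (pcharf_prime chk).
have fm_mu m z : mu z = 0 -> mu (iter m f z) = 0.
  by elim: m => //= m IHm muz; apply/phimu/IHm.
have fm1 m : iter m f 1 = 1 by elim: m => //= m ->.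
apply: subset_trans (symbolic_power_local_gen P_prime loc_P) _.
elim: n {n_gt0} => [|n IHn] x Hx; first exact: ideal_pow0.
(* The choice of m ensures Q >= 2 C + N, exactly the slack that the second factor needs below. *)
pose N := (2 * h * n.+1)%N; pose m := (C.*2 + N)%N; pose Q := ((p ^ e) ^ m)%N.
have mQ : (m <= Q)%N by apply/ltnW/ltn_expl.
have Q_gt0 : (0 < Q)%N by rewrite expn_gt0 ltnW.
have N_gt0 : (0 < N)%N by rewrite !muln_gt0 h_gt0.
(* The least a with a N > h Q + C: enough for the first factor to land in P, while leaving as much
   as possible to the exponent Q - a. *)
pose a := ((h * Q + C) %/ N).+1.
have aN_lo : (h * Q + C < a * N)%N by apply: ltn_ceil.
have aN_hi : (a * N <= h * Q + C + N)%N by rewrite mulSn addnC leq_add2r leq_trunc_div.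
have aQ : (a <= Q)%N.
  rewrite -(leq_pmul2r N_gt0); apply: leq_trans aN_hi _.
  rewrite /N in mQ *; move: mQ; rewrite /m; nia.
have [l [psi [psi' [psiC psi'C xE]]]] :=
  diagonal_subadditivity tens muE (Cartier_linear_iter m fC) (fm1 m) (fm_mu m) x
    (subnKC aQ).
rewrite xE; apply: is_ideal_sum => [|i _]; first exact: ideal_pow_ideal.
rewrite -add1n; apply: ideal_powM.
  apply/ideal_pow1/(local_gen_pow1 P_prime).
  apply: (Cartier_frobenius_power Q_gt0 (psiC i)).
  by apply: sub_frob (local_gen_exp P_prime a Hx) => //; rewrite -/N; nia.
(* Here s = 2 h n: as N = 2 h n + 2 h and a N <= h Q + C + N, the degree N (Q - a) + Q is at least
   (s + h) Q + C once Q >= 2 C + N. *)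
apply/IHn/(Cartier_frobenius_power Q_gt0 (psi'C i)).
apply: sub_frob (local_gen_exp P_prime (Q - a) Hx) => //.
rewrite -/N mulnBr [(N * a)%N]mulnC.
have NE : (N = 2 * h * n + h + h)%N by rewrite /N; lia.
move: mQ aN_hi; rewrite /m NE; nia.
Qed.
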